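(* Let $n_1,n_2,n_3,k_1,k_2,k_3$ be non-negative integers and $a,b_1,b_2,b_3$ non-negative even integers (such that the region below is defined). Put $N:=-n_3-a-b_1-b_2-b_3$. Then $$\operatorname{M}(S_{n_1,n_2,n_3,a,b_1,b_2,b_3,k_1,k_2,k_3})=\prod_{i=1}^{n_1}\binom{n_2+n_3+a+b_1+b_2+b_3+i-1}{n_2}\prod_{j=1}^{a+b_1+b_2+b_3+n_1}\binom{j+n_2-1}{j-1}^{-1}\cdot\left|\det D\right|,$$ where $D$ is the $(a+b_1+b_2+b_3)\times(a+b_1+b_2+b_3)$ matrix with columns $1\le j\le a+b_1+b_2+b_3$ and row blocks (1) $1\le i\le b_3$: $\sum_{l\ge1}\binom{n_1+\frac a2+b_1+k_3+i-1}{l+n_2-n_3+2k_3-1}\binom{l+n_2-1}{l-1}\binom{N}{j+n_1-l}$; (2) $1\le i\le a$: $\sum_{l\ge1}\binom{n_1+b_1+i-1}{l+n_2-n_3-b_3-1}\binom{l+n_2-1}{l-1}\binom{N}{j+n_1-l}$; (3) $1\le i\le b_1$: $\sum_{l\ge1}\binom{n_1-2k_1+i-1}{l+n_2-n_3-\frac a2-b_3-k_1-1}\binom{l+n_2-1}{l-1}\binom{N}{j+n_1-l}$; (4) $1\le i\le b_2$: $\sum_{l\ge1}\binom{n_1+\frac a2+b_1+k_2+i-1}{l+n_2-n_3-\frac a2-b_3-k_2-1}\binom{l+n_2-1}{l-1}\binom{N}{j+n_1-l}$.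
   Context: Triangular lattice drawn with one family of lattice lines horizontal; $\operatorname{M}(R)$ is the number of lozenge tilings of $R$. The $(N',L)$-trapezoid is the isosceles trapezoid with horizontal longer base of length $L$ at the bottom, legs of length $N'$ and lower base angles $60^\circ$; its up-pointing unit triangles lie in rows at heights $h=0,1,\dots$ (bottom row $h=0$), numbered within a row by positions $1,2,\dots$ from the left. Region $S_{n_1,n_2,n_3,a,b_1,b_2,b_3,k_1,k_2,k_3}$ (non-negative integers, $a$ even, parameters such that the holes below lie in the trapezoid and are disjoint): with $n=n_1+n_2+a+b_1+b_2+b_3$, it is obtained from the $(n,n+n_3)$-trapezoid by removing up-pointing triangles of sides $n_2,n_1,b_3,a,b_1,b_2$ whose bottom rows consist of the up-pointing unit triangles at: height $0$, positions $1,\dots,n_2$; height $0$, positions $n_2+n_3+a+b_1+b_2+b_3+1,\dots,n_1+n_2+n_3+a+b_1+b_2+b_3$; height $n_3-2k_3$, positions $n_1+\frac a2+b_1+k_3+1,\dots,n_1+\frac a2+b_1+b_3+k_3$; height $n_3+b_3$, positions $n_1+b_1+1,\dots,n_1+b_1+a$; height $n_3+\frac a2+b_3+k_1$, positions $n_1-2k_1+1,\dots,n_1-2k_1+b_1$; height $n_3+\frac a2+b_3+k_2$, positions $n_1+\frac a2+b_1+k_2+1,\dots,n_1+\frac a2+b_1+b_2+k_2$. Binomial coefficients: $\binom{x}{m}=x(x-1)\cdots(x-m+1)/m!$ for integers $m\ge0$ and $0$ for $m<0$. *)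

(* Defs.v *)
(* MathComp world, with finmap for finite subsets of the infinite lattice. *)
From mathcomp Require Export all_boot all_order all_algebra.
From mathcomp Require Export finmap.

Set Implicit Arguments.
Unset Strict Implicit.
Unset Printing Implicit Defensive.

Import Order.TTheory GRing.Theory Num.Theory.

Local Open Scope fset_scope.
Local Open Scope ring_scope.

(* Let e1 be the horizontal unit vector and e2 the unit vector at 60 degrees.
   (true, h, p) is the up-pointing unit triangle with corners
     (p-1) e1 + h e2,  p e1 + h e2,  (p-1) e1 + (h+1) e2,
   and (false, h, p) is the down-pointing unit triangle with corners
     p e1 + h e2,  (p-1) e1 + (h+1) e2,  p e1 + (h+1) e2.
   So h is the height of the row.  In a trapezoid whose lower left corner is
   the origin, the left leg runs along e2, and hence the up-pointing triangles
   of row h, read from the left, are those with p = 1, 2, ...  The down-pointing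
   triangle (false, h, p) lies between (true, h, p) and (true, h, p + 1). *)
Definition utri : Type := (bool * int * int)%type.

Definition share_edge (u v : utri) : bool :=
  match u, v with
  | (true, h, p), (false, h', p') =>
      (h', p') \in [:: (h, p - 1); (h, p); (h - 1, p)]
  | _, _ => false
  end.

(* The isosceles trapezoid with horizontal longer base L at the bottom, legs N
   (N <= L) and lower base angles of 60 degrees, whose bottom row consists of
   the up-pointing unit triangles at height h and positions p, ..., p + L - 1.
   Its row at height h + t has L - t up-pointing and L - t - 1 down-pointing
   unit triangles. *)
Definition trapezoid (h p : int) (N L : nat) : {fset utri} :=
  [fset u in [seq (true, h + t%:Z, p + q%:Z)
                | t <- iota 0 N, q <- iota 0 (L - t)]
          ++ [seq (false, h + t%:Z, p + q%:Z)
                | t <- iota 0 N, q <- iota 0 (L - t).-1]].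

(* Up-pointing triangle of side s (empty if s = 0). *)
Definition up_triangle (h p : int) (s : nat) : {fset utri} :=
  trapezoid h p s s.

Definition is_lozenge (R : {fset utri}) (P : {set R}) : bool :=
  [exists u : R, exists v : R,
     (P == [set u; v]%SET) && share_edge (val u) (val v)].

Definition is_tiling (R : {fset utri}) (T : {set {set R}}) : bool :=
  partition T [set: R]%SET && [forall P in T, is_lozenge P].

Definition M (R : {fset utri}) : nat :=
  #|[set T : {set {set R}} | is_tiling T]%SET|.

Definition S_trapezoid (n1 n2 n3 a b1 b2 b3 : nat) : {fset utri} :=
  let n := (n1 + n2 + a + b1 + b2 + b3)%N in trapezoid 0 1 n (n + n3).

(* The coordinates are computed in int, since n3 - 2 k3 and n1 - 2 k1 + 1 may
   be negative; for a nonempty hole this is then excluded by S_defined. *)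
Definition S_holes (n1 n2 n3 a b1 b2 b3 k1 k2 k3 : nat) : seq {fset utri} :=
  let a2 := a./2 in
  [:: up_triangle 0 1 n2;
      up_triangle 0 (n2 + n3 + a + b1 + b2 + b3 + 1)%N%:Z n1;
      up_triangle (n3%:Z - (2 * k3)%N%:Z) (n1 + a2 + b1 + k3 + 1)%N%:Z b3;
      up_triangle (n3 + b3)%N%:Z (n1 + b1 + 1)%N%:Z a;
      up_triangle (n3 + a2 + b3 + k1)%N%:Z (n1%:Z - (2 * k1)%N%:Z + 1) b1;
      up_triangle (n3 + a2 + b3 + k2)%N%:Z (n1 + a2 + b1 + k2 + 1)%N%:Z b2].

(* The holes lie in the trapezoid and no two of them have a unit triangle in
   common (they may touch along their boundaries). *)
Definition S_defined (n1 n2 n3 a b1 b2 b3 k1 k2 k3 : nat) : bool :=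
  let holes := S_holes n1 n2 n3 a b1 b2 b3 k1 k2 k3 in
  all (fun H => H `<=` S_trapezoid n1 n2 n3 a b1 b2 b3) holes
  && pairwise (fun H H' => [disjoint H & H']) holes.

Definition S_region (n1 n2 n3 a b1 b2 b3 k1 k2 k3 : nat) : {fset utri} :=
  S_trapezoid n1 n2 n3 a b1 b2 b3
    `\` \bigcup_(H <- S_holes n1 n2 n3 a b1 b2 b3 k1 k2 k3) H.

Definition binomz (x m : int) : rat :=
  match m with
  | Posz k => (\prod_(t < k) (x - t%:Z))%:~R / (k`!)%:R
  | Negz _ => 0
  end.

Definition D_term (n1 n2 : nat) (N x y : int) (j l : nat) : rat :=
  binomz x (l%:Z + y - 1) * binomz (l%:Z + n2%:Z - 1) (l%:Z - 1)
  * binomz N (j%:Z + n1%:Z - l%:Z).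

(* The sum over all l >= 1, cut off at l = j + n1: the terms with larger l
   vanish, as D_sumE records. *)
Definition D_sum (n1 n2 : nat) (N x y : int) (j : nat) : rat :=
  \sum_(1 <= l < (j + n1).+1) D_term n1 n2 N x y j l.

Lemma D_term_eq0 n1 n2 N x y j l :
  (j + n1 < l)%N -> D_term n1 n2 N x y j l = 0.
Proof.
move=> lt_l; rewrite /D_term.
have -> : j%:Z + n1%:Z - l%:Z = Negz (l - (j + n1)).-1.
  by rewrite NegzE prednK ?subn_gt0 // -subzn ?(ltnW lt_l) // PoszD opprB.
by rewrite mulr0.
Qed.

Lemma D_sumE n1 n2 N x y j m : (j + n1 < m)%N ->
  \sum_(1 <= l < m) D_term n1 n2 N x y j l = D_sum n1 n2 N x y j.
Proof.
move=> lt_m; rewrite (big_cat_nat _ (n := (j + n1).+1)) //=.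
rewrite [X in _ + X]big_nat_cond [X in _ + X]big1 ?addr0 // => l.
by case/andP=> /andP[lt_l _] _; apply: D_term_eq0.
Qed.

(* A block of m rows and c columns whose row i has upper entry x + i - 1 and
   lower entry l + y - 1 in the first binomial coefficient; i and j count from
   1 in the formulas, but ordinals count from 0. *)
Definition D_block (n1 n2 : nat) (N : int) (m c : nat) (x y : int) :
    'M[rat]_(m, c) :=
  \matrix_(i < m, j < c) D_sum n1 n2 N (x + i.+1%:Z - 1) y j.+1.

Definition D_matrix (n1 n2 n3 a b1 b2 b3 k1 k2 k3 : nat) :
    'M[rat]_(b3 + a + b1 + b2) :=
  let N := - n3%:Z - a%:Z - b1%:Z - b2%:Z - b3%:Z in
  let a2 := a./2 in
  let d := n2%:Z - n3%:Z in
  let block m x y := D_block n1 n2 N m (b3 + a + b1 + b2) x y in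
  col_mx (col_mx (col_mx
    (block b3 (n1 + a2 + b1 + k3)%N%:Z (d + (2 * k3)%N%:Z))
    (block a (n1 + b1)%N%:Z (d - b3%:Z)))
    (block b1 (n1%:Z - (2 * k1)%N%:Z) (d - a2%:Z - b3%:Z - k1%:Z)))
    (block b2 (n1 + a2 + b1 + k2)%N%:Z (d - a2%:Z - b3%:Z - k2%:Z)).

(* Main.v *)
Require Import Defs.
From mathcomp Require Import perm zify ring.
Import Order.TTheory GRing.Theory Num.Theory.
Local Open Scope fset_scope.
Local Open Scope ring_scope.

Set Implicit Arguments.
Unset Strict Implicit.
Unset Printing Implicit Defensive.

(* Tilings are the perfect matchings of the adjacency matrix between down- and
   up-pointing triangles.  In row-major order all of them have the same sign,
   because the holes away from the bottom row have even sides; so the number of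
   tilings is the absolute value of that determinant.  A hole may be refilled
   except for its bottom row, since the tiling of the rest of it is forced.  On
   the full trapezoid, the functions on up-pointing triangles whose sum around
   each down-pointing one vanishes are determined by their values on the left
   leg, and they are signed binomial coefficients (Pascal's rule).  The
   determinant therefore equals that of the values of these kernel functions on
   the bottom rows of the holes.  Finally, a triangular column operation and
   the Chu-Vandermonde identity clear the rows of the hole of side n1. *)

(** * Signs and determinants indexed by sequences *)

Definition inversions n (s : 'S_n) : nat :=
  (\sum_(i < n) \sum_(j < n | i < j) (s j < s i))%N.

Lemma inversions1 n : inversions (1%g : 'S_n) = 0%N.
Proof.
rewrite /inversions; apply/eqP; rewrite sum_nat_eq0; apply/forall_inP => i _.
rewrite sum_nat_eq0; apply/forall_inP => j ltij.
by rewrite !perm1 ltnNge (ltnW ltij).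
Qed.

(** Both sides are the sign of the Vandermonde determinant at the values of [s]: permuting its
    columns contributes the sign of [s], and each inversion makes one difference in the product
    negative. *)
Lemma sign_inversions n (s : 'S_n) : (-1) ^+ s = (-1) ^+ inversions s :> int.
Proof.
pose V (t : 'S_n) := Vandermonde n (\row_j ((t j : nat)%:Z) : 'rV[int]_n).
have VE : V s = col_perm s (V 1%g).
  by apply/matrixP => i j; rewrite !mxE perm1.
have := congr1 (@Num.sg _ \o determinant) VE => /=.
rewrite col_permE det_mulmx det_perm mulrC sgrM sgrX sgrN1 !det_Vandermonde.
have sgV (t : 'S_n) : Num.sg (\prod_(i < n) \prod_(j < n | (i < j)%N)
    ((\row_j (t j : nat)%:Z) 0 j - (\row_j (t j : nat)%:Z) 0 i : int))
    = (-1) ^+ inversions t.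
  rewrite /inversions -prodrXr (big_morph _ (@sgrM _) (@sgr1 _)); apply: eq_bigr => i _.
  rewrite -prodrXr (big_morph _ (@sgrM _) (@sgr1 _)); apply: eq_bigr => j ltij; rewrite !mxE.
  have /negPf : t j != t i by rewrite (inj_eq perm_inj) -val_eqE gtn_eqF.
  rewrite -val_eqE /=; case: ltngtP => // tij _; first by rewrite ltr0_sg ?subr_lt0 ?ltz_nat.
  by rewrite gtr0_sg ?subr_gt0 ?ltz_nat.
rewrite !sgV => ->; rewrite odd_permV.
by rewrite inversions1 expr0 mulr1.
Qed.

Lemma odd_perm_inversions n (s : 'S_n) : odd_perm s = odd (inversions s).
Proof.
have signI (b b' : bool) : (-1) ^+ b = (-1) ^+ b' :> int -> b = b' by case: b b' => [] [].
by apply: signI; rewrite sign_inversions signr_odd.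
Qed.

(** * Determinants up to sign *)

Section AbsDet.

Variable R : numDomainType.

(** Labelling rows and columns by lists of objects turns reindexing along bijections of triangles
    into list operations; [a0] and [b0] are only defaults of [nth]. *)
Definition seq_mx (A B : Type) (a0 : A) (b0 : B) m n (F : A -> B -> R) rs cs :=
  \matrix_(i < m, j < n) F (nth a0 rs i) (nth b0 cs j).

(* The absolute value makes the order of rows and columns irrelevant. *)
Definition absdet (A B : Type) (a0 : A) (b0 : B) (F : A -> B -> R) rs cs :=
  `|\det (seq_mx a0 b0 (size rs) (size rs) F rs cs)|.

Lemma seq_mx_cat_r (A B : Type) (a0 : A) (b0 : B) m n p F rs1 rs2 cs :
  size rs1 = m ->
  seq_mx a0 b0 (m + n) p F (rs1 ++ rs2) cs
  = col_mx (seq_mx a0 b0 m p F rs1 cs) (seq_mx a0 b0 n p F rs2 cs).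
Proof.
move=> sz; apply/matrixP => i j; rewrite !mxE nth_cat sz.
by case: splitP => k ->; rewrite mxE // addKn.
Qed.

Lemma seq_mx_cat_c (A B : Type) (a0 : A) (b0 : B) m n p F rs cs1 cs2 :
  size cs1 = m ->
  seq_mx a0 b0 p (m + n) F rs (cs1 ++ cs2)
  = row_mx (seq_mx a0 b0 p m F rs cs1) (seq_mx a0 b0 p n F rs cs2).
Proof.
move=> sz; apply/matrixP => i j; rewrite !mxE nth_cat sz.
by case: splitP => k ->; rewrite mxE // addKn.
Qed.

Lemma eq_absdet (A B : eqType) (a0 : A) (b0 : B) F G rs cs :
  size rs = size cs -> {in rs & cs, F =2 G} ->
  absdet a0 b0 F rs cs = absdet a0 b0 G rs cs.
Proof.
move=> sz FG; congr (`|\det _|); apply/matrixP => i j; rewrite !mxE.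
by apply: FG; apply: mem_nth; rewrite -?sz.
Qed.

Lemma absdet_tr (A B : Type) (a0 : A) (b0 : B) F rs cs :
  size rs = size cs ->
  absdet a0 b0 F rs cs = absdet b0 a0 (fun c r => F r c) cs rs.
Proof.
by move=> sz; rewrite /absdet -det_tr -sz; congr (`|\det _|); apply/matrixP => i j; rewrite !mxE.
Qed.

Lemma absdet_map (A B A' B' : Type) (a0 : A) (b0 : B) (a0' : A') (b0' : B')
    F (f : A -> A') (g : B -> B') rs cs :
  size rs = size cs ->
  absdet a0' b0' F (map f rs) (map g cs)
  = absdet a0 b0 (fun r c => F (f r) (g c)) rs cs.
Proof.
move=> sz; rewrite /absdet size_map; congr (`|\det _|); apply/matrixP => i j.
by rewrite !mxE (nth_map a0) // (nth_map b0) -?sz.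
Qed.

Lemma absdet_perm_rows (A : eqType) (B : Type) (a0 : A) (b0 : B) F rs rs' cs :
  perm_eq rs rs' -> absdet a0 b0 F rs cs = absdet a0 b0 F rs' cs.
Proof.
move=> rs_rs'; rewrite /absdet -(perm_size rs_rs').
have /(perm_iotaP a0)[Is Is_iota rsE] : perm_eq rs' rs by rewrite perm_sym.
have szIs : size Is = size rs by rewrite (perm_size Is_iota) size_iota.
have ltIs (i : 'I_(size rs)) : (nth 0%N Is i < size rs)%N.
  have : nth 0%N Is i \in Is by rewrite mem_nth // szIs.
  by rewrite (perm_mem Is_iota) mem_iota.
have inj_s : injective (fun i => Ordinal (ltIs i)).
  move=> i j [] /eqP; rewrite nth_uniq ?szIs //; first by move/eqP/val_inj.
  by rewrite (perm_uniq Is_iota) iota_uniq.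
have -> : seq_mx a0 b0 (size rs) (size rs) F rs' cs
    = row_perm (perm inj_s) (seq_mx a0 b0 (size rs) (size rs) F rs cs).
  apply/matrixP => i j; rewrite !mxE permE /= rsE (nth_map 0%N) ?szIs //.
by rewrite row_permE det_mulmx det_perm normrM normr_sign mul1r.
Qed.

Lemma absdet_perm (A B : eqType) (a0 : A) (b0 : B) F rs rs' cs cs' :
    size rs = size cs -> perm_eq rs rs' -> perm_eq cs cs' ->
  absdet a0 b0 F rs cs = absdet a0 b0 F rs' cs'.
Proof.
move=> sz rs_rs' cs_cs'; rewrite (absdet_perm_rows _ _ _ _ rs_rs').
have szr := perm_size rs_rs'; have szc := perm_size cs_cs'.
rewrite !(@absdet_tr A B) ?(absdet_perm_rows _ _ _ _ cs_cs') //; last by rewrite -szr.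
by rewrite -szr -szc.
Qed.

Lemma absdet_lblock (A B : eqType) (a0 : A) (b0 : B) F rs1 rs2 cs1 cs2 :
    size rs1 = size cs1 -> size rs2 = size cs2 ->
    {in rs1 & cs2, forall r c, F r c = 0} ->
  absdet a0 b0 F (rs1 ++ rs2) (cs1 ++ cs2)
  = absdet a0 b0 F rs1 cs1 * absdet a0 b0 F rs2 cs2.
Proof.
move=> sz1 sz2 F0; rewrite /absdet size_cat seq_mx_cat_r // !seq_mx_cat_c //.
rewrite [X in col_mx (row_mx _ X)](_ : _ = 0).
  by rewrite -[col_mx _ _]/(block_mx _ _ _ _) det_lblock normrM.
by apply/matrixP => i j; rewrite !mxE F0 // mem_nth // -sz2.
Qed.

Lemma absdet_mul (A B C : eqType) (a0 : A) (b0 : B) (c0 : C)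
    F G H rs ks cs :
    size rs = size ks -> size rs = size cs ->
    {in rs & cs, forall r c, F r c = \sum_(k <- ks) G r k * H k c} ->
  absdet a0 c0 F rs cs = absdet a0 b0 G rs ks * absdet b0 c0 H ks cs.
Proof.
move=> szk szc FE; rewrite /absdet -szk -normrM -det_mulmx; congr (`|\det _|).
apply/matrixP => i j; rewrite !mxE FE ?mem_nth -?szc //.
by rewrite (big_nth b0) big_mkord -szk; apply: eq_bigr => k _; rewrite !mxE.
Qed.

(** Pairing [r] with [f r] and sorting by [rank] gives a lower triangular matrix. Ties in rank are
    harmless: the hypothesis then kills the entries on both sides of the diagonal. *)
Lemma absdet_trig (A B : eqType) (a0 : A) (b0 : B) F rs (f : A -> B)
    (rank : A -> int) :
    uniq rs ->
    {in rs &, forall r r', r != r' -> (rank r <= rank r') -> F r (f r') = 0} ->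
  absdet a0 b0 F rs (map f rs) = \prod_(r <- rs) `|F r (f r)|.
Proof.
move=> uniq_rs F0; pose le := relpre rank <=%R; pose rs' := sort le rs.
have rs_rs' : perm_eq rs rs' by rewrite perm_sym perm_sort.
have trle : transitive le by move=> x y z; apply: le_trans.
have sorted_rs' : sorted le rs' by apply: sort_sorted => x y; apply: le_total.
have uniq_rs' : uniq rs' by rewrite -(perm_uniq rs_rs').
rewrite (@absdet_perm _ _ _ _ _ _ rs' _ (map f rs')) ?size_map ?perm_map //.
rewrite (perm_big _ rs_rs') /absdet /= det_trig.
  rewrite normr_prod (big_nth a0) big_mkord; apply: eq_bigr => i _.
  by rewrite !mxE (nth_map a0).
apply/is_trig_mxP => i j ltij; rewrite !mxE (nth_map a0) //.
have inrs (k : 'I_(size rs')) : nth a0 rs' k \in rs.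
  by rewrite (perm_mem rs_rs') mem_nth.
apply: F0; rewrite ?inrs //; first by rewrite nth_uniq // ltn_eqF.
have refl_le : reflexive le by move=> x; apply: lexx.
have := sorted_leq_nth trle refl_le a0 sorted_rs' i j.
by rewrite !inE !ltn_ord => /(_ isT isT (ltnW ltij)).
Qed.

Lemma absdet_scale (A B : eqType) (a0 : A) (b0 : B) F (d : A -> R) rs cs :
    size rs = size cs -> {in rs, forall r, `|d r| = 1} ->
  absdet a0 b0 (fun r c => d r * F r c) rs cs = absdet a0 b0 F rs cs.
Proof.
move=> sz d1; rewrite /absdet.
set M1 := seq_mx _ _ _ _ _ _ _; set M2 := seq_mx _ _ _ _ _ _ _.
have -> : M1 = diag_mx (\row_i d (nth a0 rs i)) *m M2.
  by rewrite mul_diag_mx; apply/matrixP => i j; rewrite !mxE.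
rewrite det_mulmx det_diag normrM normr_prod big1 ?mul1r // => i _.
by rewrite mxE d1 // mem_nth.
Qed.

End AbsDet.

(** * Binomial coefficients *)

Local Arguments binomz : simpl never.

Lemma binomz_lt0 x m : m < 0 -> binomz x m = 0.
Proof. by case: m. Qed.

Lemma binomz0 x : binomz x 0 = 1.
Proof. by rewrite /binomz /= big_ord0 fact0 divr1. Qed.

Lemma binomzS x m : binomz (x + 1) m = binomz x m + binomz x (m - 1).
Proof.
case: m => [[|k]|k]; first by rewrite !binomz0 binomz_lt0 ?addr0.
  have -> : k.+1%:Z - 1 = k%:Z by lia.
  rewrite /binomz big_ord_recl big_ord_recr /= subr0.
  have -> : \prod_(i < k) (x + 1 - (bump 0 i)%:Z) = \prod_(t < k) (x - t%:Z).
    by apply: eq_bigr => i _; rewrite /bump; lia.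
  set P := \prod_(t < k) _; rewrite factS natrM invfM !rmorphM /=.
  rewrite !rmorphD rmorphN /=.
  have f0 : k`!%:R != 0 :> rat by rewrite pnatr_eq0 -lt0n fact_gt0.
  have k0 : k.+1%:R != 0 :> rat by rewrite pnatr_eq0.
  rewrite -!pmulrn; move: k0; rewrite -natr1 => k0.
  by field; rewrite f0 k0.
by rewrite !binomz_lt0 ?addr0 //; lia.
Qed.

Lemma binomz_nat (n k : nat) : binomz n k = 'C(n, k)%:R.
Proof.
elim: n k => [|n IHn] [|k]; rewrite ?binomz0 ?bin0 //.
  by rewrite /binomz /= big_ord_recl subrr mul0r mul0r bin0n.
have -> : n.+1%:Z = n%:Z + 1 by lia.
rewrite binomzS; have -> : k.+1%:Z - 1 = k%:Z by lia.
by rewrite !IHn binS natrD.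
Qed.

(** Induction on [A] by Pascal's rule, which leaves [x] free to be negative. Terms with [l > J]
    vanish, so any cut-off beyond [J] will do. *)
Lemma binomz_vandermonde (A M : nat) (x J : int) : J < M ->
  \sum_(l < M) binomz A l * binomz x (J - l%:Z) = binomz (A%:Z + x) J.
Proof.
case: M => [|M] in J *; first by move=> ltJ0; rewrite big_ord0 binomz_lt0.
elim: A M J => [|A IHA] M J ltJM.
  have -> : 0%N%:Z + x = x by lia.
  rewrite big_ord_recl binomz0 subr0 mul1r big1 ?addr0 // => i _.
  by rewrite binomz_nat bin0n mul0r.
have -> : A.+1%:Z + x = A%:Z + x + 1 by lia.
rewrite binomzS -(IHA M) //.
have -> : binomz (A%:Z + x) (J - 1)
    = \sum_(l < M) binomz A l * binomz x (J - 1 - l%:Z).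
  case: M ltJM => [|M] ltJM; first by rewrite big_ord0 binomz_lt0 //; lia.
  by rewrite IHA //; lia.
rewrite big_ord_recl [in RHS]big_ord_recl !binomz0 !mul1r -addrA -big_split /=.
congr (_ + _); apply: eq_bigr => i _; rewrite /bump /= add1n.
have -> : A.+1%:Z = A%:Z + 1 by lia.
rewrite binomzS; have -> : i.+1%:Z - 1 = i%:Z by lia.
have -> : J - 1 - i%:Z = J - i.+1%:Z by lia.
by rewrite mulrDl.
Qed.

(** For [l <= m] both sides are the multinomial coefficient [(n+m)! / (n! l! (m-l)!)]. *)
Lemma mul_bin_bin (n m l : nat) :
  ('C(n + m, n + l) * 'C(n + l, l) = 'C(n + m, n) * 'C(m, l))%N.
Proof.
have [lt_ml|le_lm] := ltnP m l.
  by rewrite (@bin_small m l) // (@bin_small (n + m)) ?ltn_add2l // muln0 mul0n.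
apply/eqP; rewrite -(eqn_pmul2r (fact_gt0 l)) -(eqn_pmul2r (fact_gt0 n)).
rewrite -(eqn_pmul2r (fact_gt0 (m - l))).
have F1 := @bin_fact (n + m) (n + l); have F2 := @bin_fact (n + l) l.
have F3 := @bin_fact (n + m) n; have F4 := @bin_fact m l.
rewrite subnDl leq_add2l in F1; rewrite addnK leq_addl in F2.
rewrite addKn leq_addr in F3.
apply/eqP; transitivity (n + m)`!.
  by rewrite -F1 // -(F2 isT) !mulnA; lia.
by rewrite -(F3 isT) -F4 // !mulnA; lia.
Qed.

(** * Tilings and matchings *)

Definition upward (u : utri) : bool := u.1.1.
Definition height (u : utri) : int := u.1.2.
Definition pos (u : utri) : int := u.2.

Definition ups (A : {fset utri}) := [seq u <- enum_fset A | upward u].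
Definition downs (A : {fset utri}) := [seq u <- enum_fset A | ~~ upward u].

Lemma mem_ups A u : (u \in ups A) = upward u && (u \in A).
Proof. by rewrite mem_filter. Qed.

Lemma mem_downs A u : (u \in downs A) = ~~ upward u && (u \in A).
Proof. by rewrite mem_filter. Qed.

Lemma uniq_ups A : uniq (ups A).
Proof. exact: filter_uniq (fset_uniq A). Qed.

Lemma uniq_downs A : uniq (downs A).
Proof. exact: filter_uniq (fset_uniq A). Qed.

Lemma share_edgeE u v :
  share_edge u v = [&& upward u, ~~ upward v &
    (height u == height v) && ((pos u == pos v) || (pos u == pos v + 1))
    || (height u == height v + 1) && (pos u == pos v)].
Proof.
case: u v => [[[] h] p] [[[] h'] p'] //=; rewrite /height /pos /= !inE !xpair_eqE.
lia.
Qed.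

Section Matchings.

Variables (R : {fset utri}) (ds us : seq utri) (N : nat) (u0 : utri).
Hypotheses (ds_R : perm_eq ds (downs R)) (us_R : perm_eq us (ups R)).
Hypotheses (size_ds : size ds = N) (size_us : size us = N).

Definition matching (s : 'S_N) :=
  [forall i, share_edge (nth u0 us (s i)) (nth u0 ds i)].

Let d_in (i : 'I_N) : nth u0 ds i \in R.
Proof.
have : nth u0 ds i \in ds by rewrite mem_nth ?size_ds.
by rewrite (perm_mem ds_R) mem_downs => /andP[].
Qed.

Let u_in (i : 'I_N) : nth u0 us i \in R.
Proof.
have : nth u0 us i \in us by rewrite mem_nth ?size_us.
by rewrite (perm_mem us_R) mem_ups => /andP[].
Qed.

Let d i : R := [` d_in i]%fset.
Let u i : R := [` u_in i]%fset.

Let upd i : upward (val (d i)) = false.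
Proof.
have : nth u0 ds i \in ds by rewrite mem_nth ?size_ds.
by rewrite (perm_mem ds_R) mem_downs => /andP[/negPf].
Qed.

Let upu i : upward (val (u i)) = true.
Proof.
have : nth u0 us i \in us by rewrite mem_nth ?size_us.
by rewrite (perm_mem us_R) mem_ups => /andP[].
Qed.

Let d_neq_u i j : (d i == u j) = false.
Proof. by apply/eqP => e; have := upd i; rewrite e upu. Qed.

Let d_inj : injective d.
Proof.
move=> i j /(congr1 val) /= /eqP; rewrite nth_uniq ?size_ds //; first by move/eqP/val_inj.
by rewrite (perm_uniq ds_R) uniq_downs.
Qed.

Let u_inj : injective u.
Proof.
move=> i j /(congr1 val) /= /eqP; rewrite nth_uniq ?size_us //; first by move/eqP/val_inj.
by rewrite (perm_uniq us_R) uniq_ups.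
Qed.

Let dP (x : R) : ~~ upward (val x) -> exists i, x = d i.
Proof.
move=> dx; have : val x \in ds by rewrite (perm_mem ds_R) mem_downs dx (valP x).
case/(nthP u0) => i; rewrite size_ds => ltiN e.
by exists (Ordinal ltiN); apply: val_inj.
Qed.

Let uP (x : R) : upward (val x) -> exists i, x = u i.
Proof.
move=> dx; have : val x \in us by rewrite (perm_mem us_R) mem_ups dx (valP x).
case/(nthP u0) => i; rewrite size_us => ltiN e.
by exists (Ordinal ltiN); apply: val_inj.
Qed.

Let tiling_of (s : 'S_N) : {set {set R}} := [set [set u (s i); d i] | i : 'I_N]%SET.

Let tiling_ofP s : matching s -> is_tiling (tiling_of s).
Proof.
move=> /forallP match_s; apply/andP; split; last first.
  apply/forall_inP => _ /imsetP[i _ ->]; apply/existsP; exists (u (s i)).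
  by apply/existsP; exists (d i); rewrite eqxx /= match_s.
apply/and3P; split.
- apply/eqP/setP => x; rewrite inE; apply/bigcupP.
  have [/uP[j ->]|/dP[i ->]] := boolP (upward (val x)).
    exists [set u (s ((s^-1)%g j)); d ((s^-1)%g j)]%SET; first exact: imset_f.
    by rewrite permKV !inE eqxx.
  by exists [set u (s i); d i]%SET; [exact: imset_f | rewrite !inE eqxx orbT].
- apply/trivIsetP => _ _ /imsetP[i _ ->] /imsetP[j _ ->] neq.
  have neq_ij : i != j by apply: contraNneq neq => ->.
  rewrite -setI_eq0; apply/eqP/setP => x; rewrite !inE.
  apply/negP => /andP[/orP[]/eqP-> /orP[]].
  + by rewrite (inj_eq u_inj) (inj_eq perm_inj) (negPf neq_ij).
  + by rewrite eq_sym d_neq_u.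
  + by rewrite d_neq_u.
  + by rewrite (inj_eq d_inj) (negPf neq_ij).
- by apply/imsetP => -[i _ /setP/(_ (d i))]; rewrite !inE eqxx orbT.
Qed.

Let tiling_of_inj : injective tiling_of.
Proof.
move=> s t /setP st; apply/permP => i.
have : [set u (s i); d i]%SET \in tiling_of s by apply: imset_f.
rewrite st => /imsetP[j _ /setP e].
have := e (d i); rewrite !inE eqxx !d_neq_u (inj_eq d_inj) /= => /esym/eqP ij.
have := e (u (s i)); rewrite !inE eqxx (inj_eq u_inj) [_ == d j]eq_sym d_neq_u orbF /=.
by rewrite ij => /esym/eqP.
Qed.

(** The block of [d i] supplies a partner [u (g i)]. Indices with the same partner share a block,
    and a block has only one down-pointing triangle, so [g] is a permutation. *)
Let tiling_of_surj T : is_tiling T -> exists2 s, matching s & T = tiling_of s.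
Proof.
case/andP=> /and3P[/eqP coverT trivT _] /forall_inP lozT.
have blockP i : exists j, [set u j; d i]%SET \in T /\ share_edge (val (u j)) (val (d i)).
  have inT : d i \in cover T by rewrite coverT inE.
  have := lozT _ (pblock_mem inT); case/existsP=> x /existsP[y /andP[/eqP bE xy]].
  have := xy; rewrite share_edgeE => /and3P[/uP[j xE] /dP[k yE] _].
  have := mem_pblock T (d i); rewrite inT bE xE yE !inE d_neq_u (inj_eq d_inj).
  move=> /eqP ik; exists j; rewrite ik -xE -yE xy; split=> //.
  by rewrite -bE pblock_mem.
have [g gP] := fin_all_exists blockP.
have same_block i j x : x \in [set u (g i); d i]%SET -> x \in [set u (g j); d j]%SET ->
    i = j.
  move=> xi xj; have := def_pblock trivT (proj1 (gP i)) xi.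
  rewrite (def_pblock trivT (proj1 (gP j)) xj) => /setP/(_ (d i)).
  by rewrite !inE eqxx orbT d_neq_u (inj_eq d_inj) => /eqP.
have g_inj : injective g.
  move=> i j eg; apply: (same_block i j (u (g i))); first by rewrite !inE eqxx.
  by rewrite !inE eg eqxx.
exists (perm g_inj); first by apply/forallP => i; rewrite permE; case: (gP i).
apply/setP => P; apply/idP/imsetP => [PT|[i _ ->]]; last by rewrite permE; case: (gP i).
have /existsP[x /existsP[y /andP[/eqP PE]]] := lozT _ PT.
rewrite share_edgeE => /and3P[_ /dP[i yE] _]; exists i => //.
rewrite permE -(def_pblock trivT (proj1 (gP i)) (x := d i)) ?inE ?eqxx ?orbT //.
by apply/esym/def_pblock => //; rewrite PE yE !inE eqxx orbT.
Qed.

Lemma M_matchings : M R = #|[set s | matching s]|.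
Proof.
rewrite -(card_imset _ tiling_of_inj); apply: eq_card => T; rewrite !inE.
apply/idP/imsetP => [/tiling_of_surj[s ms ->]|[s]]; first by exists s; rewrite ?inE.
by rewrite inE => /tiling_ofP ? ->.
Qed.

End Matchings.

(** * The common sign of all matchings *)

Lemma sum_sym_irr_even n (e : rel 'I_n) : symmetric e -> irreflexive e ->
  ~~ odd (\sum_(i < n) \sum_(j < n) e i j)%N.
Proof.
move=> sym_e irr_e.
have -> : (\sum_(i < n) \sum_(j < n) e i j = (\sum_(i < n) \sum_(j < n | i < j) e i j).*2)%N.
  rewrite -addnn [in X in (_ = _ + X)%N](exchange_big_dep predT) //= -big_split /=.
  apply: eq_bigr => i _; rewrite (bigID (fun j : 'I_n => (i < j)%N)) /=; congr addn.
  rewrite (bigID (fun j : 'I_n => (j < i)%N)) /= [X in (_ + X)%N]big1 ?addn0.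
    by apply: eq_big => [j|j _]; [case: ltngtP | rewrite sym_e].
  move=> j; rewrite -!leqNgt -eqn_leq => /eqP/val_inj ->.
  by rewrite irr_e.
by rewrite odd_double.
Qed.

Definition rowmajor (u v : utri) : bool :=
  (height u < height v) || (height u == height v) && (pos u < pos v).

(* If [d] is matched with the up-pointing triangle above it, these are the
   triangles whose lozenges are inverted with that of [d], apart from those that
   are also matched across the same horizontal line. *)
Definition crossings (R : {fset utri}) (d : utri) : nat :=
  (count (fun e => (height e == height d) && (pos d < pos e)%R) (downs R)
   + count (fun u => (height u == height d + 1)%R && (pos u < pos d)%R) (ups R))%N.

Section Sign.

Variables (R : {fset utri}) (ds us : seq utri) (N : nat) (u0 : utri).
Hypotheses (ds_R : perm_eq ds (downs R)) (us_R : perm_eq us (ups R)).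
Hypotheses (size_ds : size ds = N) (size_us : size us = N).
Hypotheses (sorted_ds : pairwise rowmajor ds) (sorted_us : pairwise rowmajor us).

Let d (i : 'I_N) := nth u0 ds i.
Let u (i : 'I_N) := nth u0 us i.

Let lt_d (i j : 'I_N) : (i < j)%N = rowmajor (d i) (d j).
Proof.
have mono (k l : 'I_N) : (k < l)%N -> rowmajor (d k) (d l).
  by move=> ltkl; apply: (pairwiseP u0 sorted_ds); rewrite ?inE ?size_ds.
apply/idP/idP => [/mono//|]; apply: contraLR; rewrite -leqNgt leq_eqVlt.
case/predU1P => [/val_inj ->|/mono]; rewrite /rowmajor; lia.
Qed.

Let lt_u (i j : 'I_N) : (i < j)%N = rowmajor (u i) (u j).
Proof.
have mono (k l : 'I_N) : (k < l)%N -> rowmajor (u k) (u l).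
  by move=> ltkl; apply: (pairwiseP u0 sorted_us); rewrite ?inE ?size_us.
apply/idP/idP => [/mono//|]; apply: contraLR; rewrite -leqNgt leq_eqVlt.
case/predU1P => [/val_inj ->|/mono]; rewrite /rowmajor; lia.
Qed.

(* Horizontal lozenges contribute an even number to the right-hand side, so
   summing over the vertical lozenges gives, up to parity, a sum over all the
   triangles of [R], which does not depend on the matching. *)
Variable C : int -> nat.
Hypothesis crossings_C : forall x y : utri, x \in R -> y \in R -> share_edge y x ->
  height y = height x + 1 -> odd (crossings R x) = odd (C (height x) + C (height y)).

(** Up to an even number, the inversions of [s] are the crossings of its vertical lozenges. The
    resulting parity does not involve [s], so all matchings have the same sign. *)
Lemma odd_matching (s : 'S_N) : matching ds us u0 s ->
  odd_perm s = odd (\sum_(i < N) C (height (d i)) + \sum_(i < N) C (height (u i)))%N.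
Proof.
move=> /forallP ms; rewrite odd_perm_inversions.
(* [v i] says that lozenge [i] is vertical, that is, crosses a horizontal lattice line; [e i j]
   marks two distinct vertical lozenges crossing the same line. *)
pose v (i : 'I_N) := height (u (s i)) == height (d i) + 1.
pose e (i j : 'I_N) := [&& v i, v j, i != j & height (d i) == height (d j)].
have even_e : ~~ odd (\sum_i \sum_j e i j)%N.
  apply: sum_sym_irr_even => [i j|i]; rewrite /e ?eqxx ?andbF //.
  by rewrite eq_sym (eq_sym (height _)) andbCA.
(* If [i < j] are inverted, then lozenge [i] must be vertical. Given that, the two indicators on the
   right catch every inversion, and in excess exactly the pairs marked by [e]. *)
have vE (i j : 'I_N) : (((i < j) && (s j < s i))%N + e i j = v i *
    (((height (d j) == height (d i)) && (pos (d i) < pos (d j))%R)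
     + ((height (u (s j)) == height (d i) + 1)%R && (pos (u (s j)) < pos (d i))%R)))%N.
  have := lt_d i j; have := lt_d j i; have := lt_u (s j) (s i).
  have : (i != j) = (i < j)%N || (j < i)%N by rewrite neq_ltn.
  have := ms i; have := ms j; rewrite !share_edgeE /e /v /rowmajor -!/(d _) -!/(u _).
  move: (height (d i)) (height (d j)) (pos (d i)) (pos (d j)) => hi hj pi pj.
  move: (height (u (s i))) (height (u (s j))) (pos (u (s i))) (pos (u (s j))).
  move=> hi' hj' pi' pj' /and3P[_ _ mj] /and3P[_ _ mi].
  move: (i != j) (i < j)%N (j < i)%N (s j < s i)%N => b1 b2 b3 b4.
  lia.
have invE : (inversions s + \sum_i \sum_j e i j = \sum_i v i * crossings R (d i))%N.
  rewrite -big_split; apply: eq_bigr => i _ /=.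
  rewrite big_mkcond -big_split /=.
  transitivity (\sum_j v i *
    (((height (d j) == height (d i)) && (pos (d i) < pos (d j))%R)
     + ((height (u (s j)) == height (d i) + 1)%R && (pos (u (s j)) < pos (d i))%R)))%N.
    by apply: eq_bigr => j _; rewrite -vE; case: (i < j)%N.
  rewrite -big_distrr big_split /=; congr (_ * (_ + _))%N.
    rewrite -(seq.permP ds_R) -sum1_count [RHS]big_mkcond [RHS](big_nth u0).
    rewrite [RHS]big_mkord size_ds.
    by apply: eq_bigr => j _; rewrite /d; case: ifP.
  rewrite -(seq.permP us_R) -sum1_count [RHS]big_mkcond [RHS](big_nth u0).
    rewrite [RHS]big_mkord size_us.
  rewrite [RHS](reindex_inj (@perm_inj _ s)).
  by apply: eq_bigr => j _; rewrite /u; case: ifP.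
have -> : odd (inversions s) = odd (\sum_i v i * crossings R (d i))%N.
  by rewrite -invE oddD (negPf even_e) addbF.
rewrite [X in (_ + X)%N](reindex_inj (@perm_inj _ s)) /= -big_split /=.
rewrite !(big_morph odd oddD (erefl _)); apply: eq_bigr => i _.
have din : d i \in R.
  have : d i \in ds by rewrite mem_nth ?size_ds.
  by rewrite (perm_mem ds_R) mem_downs => /andP[].
have uin : u (s i) \in R.
  have : u (s i) \in us by rewrite mem_nth ?size_us.
  by rewrite (perm_mem us_R) mem_ups => /andP[].
have := ms i; rewrite /v -/(d i) -/(u _) => mi; case: eqVneq => [up|nup].
  by rewrite mul1n (crossings_C din uin mi up) up.
have -> : height (u (s i)) = height (d i) by move: mi nup; rewrite share_edgeE; lia.
by rewrite addnn odd_double.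
Qed.

(* A down-pointing [r] gives its row of the adjacency matrix, an up-pointing [r]
   the unit row vector that evaluates at [r]. *)
Definition incidence (r c : utri) : rat :=
  (if upward r then r == c else share_edge c r)%:R.

(** In the Leibniz expansion only matchings give nonzero terms, and these all carry the same
    sign. *)
Lemma M_absdet : (M R)%:R = absdet u0 u0 incidence ds us.
Proof.
rewrite (M_matchings u0 ds_R us_R size_ds size_us) /absdet /determinant.
rewrite size_ds.
pose par := odd (\sum_(i < N) C (height (d i)) + \sum_(i < N) C (height (u i)))%N.
rewrite (eq_bigr (fun s : 'S_N => (-1) ^+ par * (matching ds us u0 s)%:R)).
  rewrite -big_distrr normrM normr_sign mul1r -natr_sum normr_nat; congr (_%:R).
  by rewrite -sum1_card big_mkcond; apply: eq_bigr => s _; rewrite inE; case: ifP.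
move=> s _; have -> : \prod_i seq_mx u0 u0 N N incidence ds us i (s i)
    = (matching ds us u0 s)%:R.
  have entry i : seq_mx u0 u0 N N incidence ds us i (s i)
      = (share_edge (nth u0 us (s i)) (nth u0 ds i))%:R.
    rewrite mxE /incidence; have : d i \in ds by rewrite mem_nth ?size_ds.
    by rewrite (perm_mem ds_R) mem_downs => /andP[/negPf ->].
  have [/forallP ms|/forallPn[i nsi]] := boolP (matching _ _ _ s).
    by rewrite big1 // => i _; rewrite entry ms.
  by rewrite (bigD1 i) //= entry (negPf nsi) mul0r.
have [ms|] := boolP (matching _ _ _ s); first by rewrite (odd_matching ms).
by rewrite !mulr0.
Qed.

End Sign.

(** * Trapezoids with triangular holes *)

Lemma uniq_flatten_pairwise (T : eqType) (ss : seq (seq T)) :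
  pairwise (fun s t : seq T => ~~ has (mem s) t) ss -> all uniq ss -> uniq (flatten ss).
Proof.
elim: ss => //= s ss IHss /andP[/allP s_ss pw] /andP[uniq_s uniq_ss].
rewrite cat_uniq uniq_s IHss // andbT.
apply/hasPn => x /flattenP[t /s_ss /hasPn st xt]; exact: st.
Qed.

(** Linear inequalities in height and position let [lia] settle the geometry. Rows have one
    down-pointing triangle fewer, whence the summand [(~~ upward u)%:Z]. *)
Lemma in_trapezoid h p (N L : nat) u : (N <= L)%N ->
  (u \in trapezoid h p N L)
  = [&& h <= height u, height u < h + N%:Z, p <= pos u
      & pos u + (height u - h) + (~~ upward u)%:Z < p + L%:Z].
Proof.
move=> leNL; rewrite in_fset /= mem_cat.
case: u => [[b k] q]; rewrite /upward /height /pos /=.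
apply/idP/idP.
  case/orP => /allpairsPdep[t [r]]; rewrite !mem_iota /= => -[lt_t lt_r [-> -> ->]] /=; lia.
move=> /and4P[h1 h2 h3 h4].
have kE : k = h + `|k - h|%N%:Z by lia.
have qE : q = p + `|q - p|%N%:Z by lia.
apply/orP; case: b h4 => /= h4; [left | right]; apply/allpairsPdep.
  exists `|k - h|%N, `|q - p|%N; rewrite !mem_iota /= -kE -qE; split=> //; lia.
exists `|k - h|%N, `|q - p|%N; rewrite !mem_iota /= -kE -qE; split=> //; lia.
Qed.

(** A hole is encoded by its height, the first position of its bottom row, and its side. *)
Definition hole_set (t : int * int * nat) := up_triangle t.1.1 t.1.2 t.2.

Definition base (t : int * int * nat) : seq utri :=
  [seq (true, t.1.1, t.1.2 + q%:Z) | q <- iota 0 t.2].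

Lemma in_hole_set t u :
  (u \in hole_set t) = [&& t.1.1 <= height u, t.1.2 <= pos u
    & pos u + (height u - t.1.1) + (~~ upward u)%:Z < t.1.2 + t.2%:Z].
Proof. by rewrite in_trapezoid //; apply/idP/idP; lia. Qed.

Lemma mem_base t u : (u \in base t) =
  [&& upward u, height u == t.1.1, t.1.2 <= pos u & pos u < t.1.2 + t.2%:Z].
Proof.
case: u => [[b h] p]; rewrite /upward /height /pos /=; apply/mapP/idP.
  by case=> q; rewrite mem_iota => ? [-> -> ->]; lia.
case: b => //= /and3P[/eqP -> le_p lt_p].
exists `|p - t.1.2|%N; first by rewrite mem_iota; lia.
by congr (_, _); lia.
Qed.

Lemma uniq_base t : uniq (base t).
Proof. by rewrite map_inj_uniq ?iota_uniq // => i j [] /addrI []. Qed.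

Lemma sub_base t : {subset base t <= hole_set t}.
Proof. by move=> u; rewrite mem_base in_hole_set; lia. Qed.

Lemma sort_rowmajor (s : seq utri) b : uniq s -> {in s, forall u, upward u = b} ->
  exists2 t, perm_eq t s & pairwise rowmajor t.
Proof.
move=> uniq_s up_s.
pose le u v := (height u < height v) || (height u == height v) && (pos u <= pos v).
have le_total : total le by move=> u v; rewrite /le; clear; lia.
have le_trans : transitive le by move=> u v w; rewrite /le; clear; lia.
have perm_s : perm_eq (sort le s) s by rewrite perm_sort.
exists (sort le s) => //.
have := sort_sorted le_total s; rewrite (sorted_pairwise le_trans).
have : uniq (sort le s) by rewrite sort_uniq.
have {up_s}: {in sort le s, forall u, upward u = b}.
  by move=> u; rewrite mem_sort; apply: up_s.
elim: (sort le s) => //= u t IHt up_t /andP[ut /IHt{}IHt] /andP[/allP le_ut /IHt{}IHt].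
rewrite IHt ?andbT => [|v vt]; last by rewrite up_t // inE vt orbT.
apply/allP => v vt; have := le_ut v vt.
have : u != v by apply: contraNneq ut => ->.
have := up_t v; have := up_t u; rewrite !in_cons eqxx vt orbT /= /rowmajor /le.
case: (u) (v) => [[c h] p] [[c' h'] p']; rewrite /upward /height /pos /= => -> // -> //.
rewrite !xpair_eqE eqxx /=; clear; lia.
Qed.

Definition origin : utri := (true, 0, 0).

Section Holes.

Variables (n L : nat) (hs : seq (int * int * nat)).

Let T := trapezoid 0 1 n L.
Let H := \bigcup_(A <- map hole_set hs) A.
Let R := T `\` H.
Let X := flatten (map base hs).

(** The trapezoid has [n] more up- than down-pointing triangles, and a hole of side [s] has [s]
    more; hence [sum_hs] balances [R]. By [even_hs], odd sides occur only at height 0, which makes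
    the signs agree. *)
Hypotheses (le_nL : (n <= L)%N).
Hypotheses (sub_hs : all (fun A => A `<=` T) (map hole_set hs)).
Hypotheses (disj_hs : pairwise (fun A B => [disjoint A & B]) (map hole_set hs)).
Hypotheses (sum_hs : (\sum_(t <- hs) t.2 = n)%N).
Hypotheses (even_hs : {in hs, forall t, odd t.2 -> t.1.1 = 0}).

Let in_T u : (u \in T) = [&& 0 <= height u, height u < n%:Z, 1 <= pos u
    & pos u + height u + (~~ upward u)%:Z <= L%:Z].
Proof. by rewrite in_trapezoid // subr0 add0r; apply/idP/idP; clear; lia. Qed.

Let mem_H u : reflect (exists2 t, t \in hs & u \in hole_set t) (u \in H).
Proof.
rewrite /H; apply: (iffP (bigfcupP _ _ _ _)) => [[A /andP[/mapP[t ths ->] _] uA]|[t ths ut]].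
  by exists t.
by exists (hole_set t) => //; rewrite map_f.
Qed.

Let mem_X u : reflect (exists2 t, t \in hs & u \in base t) (u \in X).
Proof.
rewrite /X; apply: (iffP flatten_mapP) => [[t ths ut]|[t ths ut]]; by exists t.
Qed.

Let sub_HT : H `<=` T.
Proof.
apply/fsubsetP => u /mem_H[t ths ut].
by have /allP/(_ _ (map_f _ ths))/fsubsetP/(_ _ ut) := sub_hs.
Qed.

Let sub_XH u : u \in X -> u \in H.
Proof. by case/mem_X => t ths /sub_base ut; apply/mem_H; exists t. Qed.

Let upX u : u \in X -> upward u.
Proof. by case/mem_X => t ths; rewrite mem_base => /andP[]. Qed.

Let hole_unique t t' u : t \in hs -> t' \in hs ->
  u \in hole_set t -> u \in hole_set t' -> t = t'.
Proof.
move: disj_hs; rewrite pairwise_map.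
elim: hs => //= t1 s IHs /andP[/allP t1_s pw]; rewrite !in_cons.
case/predU1P => [->|ts] /predU1P[->|t's] // ut ut'; last exact: IHs.
  by have /fdisjointP/(_ _ ut) := t1_s _ t's; rewrite ut'.
by have /fdisjointP/(_ _ ut') := t1_s _ ts; rewrite ut.
Qed.

Let uniq_X : uniq X.
Proof.
apply: uniq_flatten_pairwise; last by apply/allP => _ /mapP[t _ ->]; apply: uniq_base.
move: disj_hs; rewrite !pairwise_map; apply: sub_pairwise => t t' /fdisjointP tt'.
apply/hasPn => u /sub_base ut'; apply/negP => /sub_base ut.
by have := tt' _ ut; rewrite ut'.
Qed.

Let size_X : size X = n.
Proof.
rewrite size_flatten /shape -map_comp sumnE big_map -sum_hs.
by apply: eq_bigr => t _; rewrite /= size_map size_iota.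
Qed.

(** Fixing the up-pointing triangles lets this map carry [downs H ++ X] onto [ups H]: a hole without
    its bottom row is tiled by vertical lozenges. *)
Definition mate (u : utri) : utri :=
  if upward u then u else (true, height u + 1, pos u).

Definition right_of (u : utri) : utri :=
  if upward u then u else (true, height u, pos u + 1).

Let mateE u : ~~ upward u ->
  [/\ upward (mate u), height (mate u) = height u + 1 & pos (mate u) = pos u].
Proof. by rewrite /mate => /negPf ->. Qed.

Let legs := [seq (true, h%:Z, 1) : utri | h <- iota 0 n].

Let mem_legs u : (u \in legs) = [&& upward u, pos u == 1 & u \in T].
Proof.
rewrite in_T; case: u => [[b h] p]; rewrite /upward /height /pos /=; apply/mapP/idP.
  by case=> q; rewrite mem_iota => ? [-> -> ->] /=; lia.
case: b => //= /and5P[/eqP -> ? ? ? ?].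
exists `|h|%N; first by rewrite mem_iota; lia.
by congr (_, _, _); lia.
Qed.

Let mate_inj : {in downs H ++ X &, injective mate}.
Proof.
move=> u v; rewrite !mem_cat !mem_downs /mate => /orP[/andP[du uH]|uX] /orP[/andP[dv vH]|vX].
+ rewrite (negPf du) (negPf dv); case: u v du dv {uH vH} => [[[] ?] ?] [[[] ?] ?] //= _ _ [].
  by rewrite /height /pos /= => /addIr -> ->.
+ rewrite (negPf du) (upX vX) => vE; have /mem_H[t ths ut] := uH.
  have /mem_X[t' t's vt'] := vX.
  have tt' : t = t'.
    apply: (hole_unique (u := v)) => //; last exact: sub_base.
    move: ut; rewrite !in_hole_set -vE du /height /pos /upward /=; clear; lia.
  move: ut vt'; rewrite tt' in_hole_set mem_base -vE /height /=; clear; lia.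
+ rewrite (negPf dv) (upX uX) => uE; have /mem_H[t ths vt] := vH.
  have /mem_X[t' t's ut'] := uX.
  have tt' : t = t'.
    apply: (hole_unique (u := u)) => //; last exact: sub_base.
    move: vt; rewrite !in_hole_set uE dv /height /pos /upward /=; clear; lia.
  move: vt ut'; rewrite tt' in_hole_set mem_base uE /height /=; clear; lia.
+ by rewrite !upX.
Qed.

Let mate_H : perm_eq (map mate (downs H ++ X)) (ups H).
Proof.
apply: uniq_perm; first 2 last.
- move=> u; rewrite mem_ups; apply/mapP/andP => [[v]|[upu /mem_H[t ths ut]]].
    rewrite mem_cat mem_downs => /orP[/andP[dv /mem_H[t ths vt]] ->|vX ->].
      rewrite /mate (negPf dv); split=> //; apply/mem_H; exists t => //.
      by move: vt; rewrite !in_hole_set /= dv; rewrite /height /pos /upward /=; clear; lia.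
    by rewrite /mate (upX vX); split; [exact: upX | exact: sub_XH].
  have [ub|nub] := boolP (u \in base t).
    exists u; last by rewrite /mate upu.
    by rewrite mem_cat; apply/orP; right; apply/mem_X; exists t.
  exists (false, height u - 1, pos u).
    rewrite mem_cat mem_downs /=; apply/orP; left; apply/mem_H; exists t => //.
    by move: ut nub; rewrite !in_hole_set mem_base upu /height /pos /upward /=; clear; lia.
  by rewrite /mate /= subrK; case: u upu {ut nub} => [[[] ?] ?].
- rewrite map_inj_in_uniq.
    rewrite cat_uniq uniq_downs uniq_X andbT; apply/hasPn => u /upX upu.
    by rewrite mem_downs upu.
  exact: mate_inj.
- exact: uniq_ups.
Qed.

Let right_of_T : perm_eq (map right_of (downs T) ++ legs) (ups T).
Proof.
have inj_r : {in downs T &, injective right_of}.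
  move=> [[bu hu] pu] [[bv hv] pv]; rewrite !mem_downs /right_of.
  by case: bu bv => [] [] //= _ _ []; rewrite /height /pos /= => -> /addIr ->.
apply: uniq_perm; first 2 last.
- move=> u; rewrite mem_cat mem_legs mem_ups; apply/orP/andP.
    case=> [/mapP[v]|/and3P[]//]; rewrite mem_downs => /andP[dv vT ->].
    move: vT; rewrite /right_of (negPf dv) !in_T dv /height /pos /upward /=; clear; lia.
  move=> [upu uT]; have [p1|p1] := eqVneq (pos u) 1; first by right; apply/and3P.
  left; apply/mapP; exists (false, height u, pos u - 1).
    rewrite mem_downs /=; move: uT p1; rewrite !in_T upu /height /pos /upward /=; clear; lia.
  by rewrite /right_of /= subrK; case: u upu {uT p1} => [[[] ?] ?].
- rewrite cat_uniq map_inj_in_uniq // uniq_downs /= map_inj_uniq ?iota_uniq ?andbT;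
    last by move=> ? ? [].
  apply/hasPn => u; rewrite mem_legs => /and3P[upu /eqP p1 uT]; apply/mapP => -[v].
  rewrite mem_downs => /andP[dv]; rewrite in_T /right_of (negPf dv) => vT uE.
  by move: vT p1; rewrite uE /height /pos /upward /=; clear; lia.
- exact: uniq_ups.
Qed.

Let mem_R u : (u \in R) = (u \notin H) && (u \in T).
Proof. exact: in_fsetD. Qed.

(** * Parity of the crossings *)

(** This plays the role of [C]. The sum of its values at two consecutive heights has the parity of
    the number of up-pointing triangles in the upper row, plus one; [|h|] supplies this one, for the
    triangle matched upwards is not among its own crossings. *)
Let potential h := (count (fun u => height u <= h)%R (ups R) + `|h|)%N.

(** A bottom row at the height of a triangle outside the holes lies entirely to its left or entirely
    to its right, and above height 0 its length is even. *)
Let even_X h p : (true, h, p) \in R -> 0 < h ->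
  ~~ odd (count (fun u => (height u == h) && (p < pos u)) X).
Proof.
move=> yR h0; rewrite count_flatten sumnE !big_map (big_morph odd oddD (erefl _)).
rewrite big_seq big1 // => t ths; apply/negbTE.
have yt : (true, h, p) \notin hole_set t.
  by move: yR; rewrite mem_R => /andP[/mem_H yH _]; apply/negP => yt; apply: yH; exists t.
have [/eqP ht /=|/negPf ht] := boolP (t.1.1 == h); last first.
  rewrite (eq_in_count (a2 := pred0)) ?count_pred0 // => u.
  by rewrite mem_base => /and4P[_ /eqP -> _ _]; rewrite /= ht.
have even_t : ~~ odd t.2.
  by apply/negP => /(even_hs ths); rewrite ht => e; rewrite e ltxx in h0.
have [lep|ltp] := lerP t.1.2 p.
  rewrite (eq_in_count (a2 := pred0)) ?count_pred0 // => u.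
  rewrite mem_base => /and4P[_ _ _ ltu] /=.
  move: yt ltu; rewrite in_hole_set ht /height /pos /upward /= lexx lep subrr !addr0 /=.
  by clear; lia.
rewrite (eq_in_count (a2 := predT)) ?count_predT ?size_map ?size_iota // => u.
by rewrite mem_base => /and4P[_ /eqP -> leu _]; rewrite /= ht eqxx (lt_le_trans ltp leu).
Qed.

(** Lifting by [mate] the down-pointing triangles right of [x] gives the up-pointing ones right of
    [y], in [R] or in [X]; the latter are even in number. Up to parity, the crossings are thus the
    up-pointing triangles of [R] in the row of [y], except [y]. *)
Let crossings_parity x y : x \in R -> y \in R -> share_edge y x ->
  height y = height x + 1 ->
  odd (crossings R x) = odd (potential (height x) + potential (height y)).
Proof.
move=> xR yR; rewrite share_edgeE => /and3P[upy dx xy] hy.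
have py : pos y = pos x by move: xy hy; clear; lia.
have [xT yT] : x \in T /\ y \in T by move: xR yR; rewrite !mem_R => /andP[_ ->] /andP[].
have yE : y = (true, height x + 1, pos x).
  by rewrite -hy -py; case: (y) upy => [[[] ?] ?].
have hx0 : 0 <= height x by move: xT; rewrite in_T; clear; lia.
pose Pd u := (height u == height x) && (pos x < pos u).
pose Pu u := (height u == height x + 1) && (pos x < pos u).
have countE : count Pd (downs R) = (count Pu (ups R) + count Pu X)%N.
  rewrite -count_cat -!size_filter -(size_map mate); apply/perm_size/uniq_perm.
  - rewrite map_inj_in_uniq; first exact: filter_uniq (uniq_downs R).
    move=> [[bu hu] pu] [[bv hv] pv]; rewrite !mem_filter /mate /upward /height /pos /=.
    by case: bu bv => [] [] //=; rewrite ?andbF //= => _ _ [] /addIr -> ->.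
  - apply: filter_uniq; rewrite cat_uniq uniq_ups uniq_X andbT.
    apply/hasPn => u /sub_XH uH; apply/negP; rewrite mem_ups mem_R => /and3P[_].
    by rewrite uH.
  move=> u; rewrite mem_filter mem_cat mem_ups; apply/mapP/idP.
    case=> v; rewrite mem_filter mem_downs => /andP[/andP[/eqP hv pv] /andP[dv vR]] uE.
    have := mateE dv; rewrite -uE => -[upu hu pu].
    have uT : u \in T.
      by move: pv yT xT vR; rewrite mem_R !in_T dv dx upu upy hy hu pu hv; clear; lia.
    rewrite /Pu hu hv pu eqxx pv upu mem_R uT andbT /=.
    have [uH|//] := boolP (u \in H).
    have /mem_H[t ths ut] := uH; apply/orP; right; apply/mem_X; exists t => //.
    have : v \notin hole_set t.
      move: vR; rewrite mem_R => /andP[/mem_H vH _]; apply/negP => vt.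
      by apply: vH; exists t.
    by move: ut; rewrite mem_base !in_hole_set upu dv hu pu; clear; lia.
  move=> /andP[/andP[/eqP hu pu] uRX].
  have upu : upward u by case/orP: uRX => [/andP[]|/upX].
  have uT : u \in T.
    case/orP: uRX => [|/sub_XH/(fsubsetP sub_HT)//]; by rewrite mem_R => /and3P[].
  have [v [dv hv pv uE]] : exists v, [/\ ~~ upward v, height v = height x,
      pos v = pos u & u = mate v].
    exists (false, height x, pos u); split=> //.
    by rewrite /mate /= -[height (_, _, _)]/(height x) -hu; case: (u) upu => [[[] ?] ?].
  exists v => //; rewrite mem_filter mem_downs dv /Pd hv eqxx pv pu mem_R /=.
  apply/andP; split; last by move: hx0 uT; rewrite !in_T upu dv hu hv pv; clear; lia.
  apply/mem_H => -[t ths vt].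
  have ut : u \in hole_set t.
    by move: vt; rewrite !in_hole_set upu dv hu hv pv; clear; lia.
  case/orP: uRX => [|/mem_X[t' t's ut']].
    by rewrite upu mem_R /= => /andP[/mem_H uH _]; apply: uH; exists t.
  have tt' := hole_unique ths t's ut (sub_base ut'); move: ut' vt.
  by rewrite -tt' mem_base in_hole_set hu hv; clear; lia.
have even_XR := even_X (etrans (congr1 (fun z => z \in R) (esym yE)) yR).
have {even_XR} := even_XR ltac:(clear -hx0; lia); rewrite -/Pu => even_XR.
have potE : count (fun u => height u <= height y)%R (ups R)
    = (count (fun u => height u <= height x)%R (ups R)
       + (count Pu (ups R) + 1
          + count (fun u => (height u == height x + 1)%R && (pos u < pos x)%R) (ups R)))%N.
  have <- : count_mem y (ups R) = 1%N by rewrite count_uniq_mem ?uniq_ups // mem_ups upy yR.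
  have cE (A : pred utri) : count A (ups R) = (\sum_(u <- ups R) A u)%N.
    by rewrite -sum1_count big_mkcond; apply: eq_bigr => u _; case: (A u).
  rewrite !cE -!big_split big_seq [RHS]big_seq /=.
  apply: eq_bigr => u; rewrite mem_ups => /andP[upu _].
  have -> : (u == y) = (height u == height x + 1) && (pos u == pos x).
    by rewrite yE; case: (u) upu => [[[] ?] ?] //=; rewrite !xpair_eqE.
  rewrite /Pu hy; move: (height u) (pos u) => hu pu; clear; lia.
rewrite /potential potE (_ : crossings R x = (count Pd (downs R)
  + count (fun u => (height u == height x + 1)%R && (pos u < pos x)%R) (ups R))%N) //.
by rewrite countE hy; move: even_XR hx0; clear; lia.
Qed.

(** * Refilling the holes above their bottom rows *)

Let perm_T (p : pred utri) :
  perm_eq [seq u <- T | p u] ([seq u <- H | p u] ++ [seq u <- R | p u]).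
Proof.
apply: uniq_perm; first exact: filter_uniq (fset_uniq T).
  rewrite cat_uniq !filter_uniq ?fset_uniq ?andbT //=.
  by apply/hasPn => u; rewrite !mem_filter mem_R => /and3P[-> /negPf-> _].
move=> u; rewrite mem_cat !mem_filter mem_R -andb_orr; congr (_ && _).
by have [/(fsubsetP sub_HT)-> //|] := boolP (u \in H).
Qed.

Let size_downs_ups :
  [/\ size (downs R) = size (ups R), size (downs H ++ X) = size (ups H)
    & size (downs T ++ X) = size (ups T)].
Proof.
have eu : size (ups T) = (size (ups H) + size (ups R))%N.
  by rewrite -size_cat; apply: perm_size (perm_T _).
have ed : size (downs T) = (size (downs H) + size (downs R))%N.
  by rewrite -size_cat; apply: perm_size (perm_T _).
have := perm_size right_of_T; have := perm_size mate_H.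
rewrite !size_map !size_cat !size_map size_iota size_X eu ed.
move=> eH eT; split=> //; apply: (@addnI (size (downs H) + n)%N).
by rewrite addnAC eT eH.
Qed.

(** The up-pointing neighbours of a down-pointing triangle in a hole lie in that hole, so the matrix
    is block triangular for [H] and [R]; the block of [H] is unitriangular along [mate]. *)
Let absdet_fill :
  absdet origin origin incidence (downs T ++ X) (ups T)
  = absdet origin origin incidence (downs R) (ups R).
Proof.
have [szR szH szT] := size_downs_ups.
rewrite (absdet_perm origin origin incidence (rs' := (downs H ++ X) ++ downs R)
  (cs' := ups H ++ ups R)) //; first last.
- exact: perm_T.
- apply: (@perm_trans _ ((downs H ++ downs R) ++ X)).
    by rewrite perm_cat2r; apply: perm_T.
  by rewrite -!catA perm_cat2l perm_catC.
rewrite absdet_lblock // => [|r c]; last first.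
  rewrite mem_ups mem_R => rHX /and3P[upc cH cT]; apply/eqP.
  rewrite /incidence pnatr_eq0 eqb0.
  move: rHX; rewrite mem_cat mem_downs => /orP[/andP[dr rH]|rX].
    rewrite (negPf dr); apply: contraNN cH; rewrite share_edgeE => /and3P[_ _ cr].
    have /mem_H[t ths rt] := rH; apply/mem_H; exists t => //.
    by move: rt cr; rewrite !in_hole_set upc dr; clear; lia.
  by rewrite (upX rX); apply: contraNneq cH => <-; apply: sub_XH.
rewrite (absdet_perm origin origin incidence (rs' := downs H ++ X)
  (cs' := map mate (downs H ++ X))) // 1?perm_sym ?mate_H //.
(* Of the neighbours of a down-pointing [r], only [mate r] lies above the height of [r]. *)
rewrite (absdet_trig origin origin (rank := fun r => height (mate r))).
- rewrite big_seq big1 ?mul1r // => r _; rewrite /incidence.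
  have [upr|dr] := boolP (upward r); first by rewrite /mate upr eqxx normr1.
  have [um hm pm] := mateE dr; rewrite share_edgeE um dr hm pm eqxx.
  by rewrite (_ : (_ || _) = true) ?normr1 // orbC eqxx.
- by rewrite (@map_uniq _ _ mate) // (perm_uniq mate_H) uniq_ups.
move=> r r' rHX r'HX neq_r le_r; apply/eqP; rewrite /incidence pnatr_eq0 eqb0.
have neq_m : mate r != mate r' by apply: contraNneq neq_r => /mate_inj->.
have [upr|dr] := boolP (upward r); first by move: neq_m; rewrite {1}/mate upr.
apply: contraNN neq_m; have [um hm pm] := mateE dr.
rewrite share_edgeE => /and3P[um' _ adj]; move: le_r adj um um' hm pm.
case: (mate r) (mate r') => [[[] h] p] [[[] h'] p'] //.
rewrite /height /pos /= -/(height r) -/(pos r).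
move: (height r) (pos r) => a b le_h adj _ _ hE pE.
rewrite !xpair_eqE eqxx /=; move: le_h adj hE pE; clear; lia.
Qed.

(* The function that is -1 at [c], is 0 elsewhere on the left leg, and sums to
   zero around each down-pointing triangle. *)
Let leg_kernel (u c : utri) : rat :=
  (-1) ^+ `|pos u|%N * binomz (pos u - 1) (height c - height u).

(** Signs alternate with the position, so the three values around [r] cancel by Pascal's rule. For
    [r] in the top row the upper neighbour lies outside [T], but the kernel vanishes there since [c]
    is lower. *)
Let leg_kernel_sum (r c : utri) : r \in downs T -> c \in legs ->
  \sum_(k <- ups T) incidence r k * leg_kernel k c = 0.
Proof.
rewrite mem_downs mem_legs => /andP[dr rT] /and3P[upc /eqP c1 cT].
pose v1 : utri := (true, height r, pos r).
pose v2 : utri := (true, height r, pos r + 1).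
pose v3 : utri := (true, height r + 1, pos r).
have pick (v : utri) : upward v -> (v \notin T -> leg_kernel v c = 0) ->
    \sum_(k <- ups T) (k == v)%:R * leg_kernel k c = leg_kernel v c.
  move=> upv vT; have [vin|/vT kv] := boolP (v \in T).
    rewrite (bigD1_seq v) ?uniq_ups ?mem_ups ?upv //= eqxx mul1r big1 ?addr0 // => k kv.
    by rewrite (negPf kv) mul0r.
  by rewrite kv big1 // => k _; case: eqP => [->|_]; rewrite ?kv ?mulr0 ?mul0r.
rewrite big_seq (eq_bigr (fun k => (k == v1)%:R * leg_kernel k c + (k == v2)%:R * leg_kernel k c
    + (k == v3)%:R * leg_kernel k c)).
  rewrite -big_seq !big_split /= !pick //.
  - have p1 : 0 < pos r by move: rT; rewrite in_T; clear; lia.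
    rewrite /leg_kernel /v1 /v2 /v3; rewrite /height /pos /= -/(height c) -/(height r) -/(pos r).
    have -> : `|(pos r + 1)%R|%N = `|pos r|%N.+1 by move: p1; clear; lia.
    have -> : pos r + 1 - 1 = (pos r - 1) + 1 by rewrite addrK subrK.
    rewrite binomzS exprS (_ : height c - (height r + 1) = height c - height r - 1).
      by ring.
    by rewrite opprD addrA.
  - move=> v3T; rewrite /leg_kernel [X in _ * X]binomz_lt0 ?mulr0 //.
    move: v3T rT cT; rewrite !in_T dr /v3 /height /pos /upward /=; clear; lia.
  - by rewrite !in_T dr in rT *; move: rT; rewrite /v2 /height /pos /upward /= => ? /negP[]; lia.
  - by rewrite !in_T dr in rT *; move: rT; rewrite /v1 /height /pos /upward /= => ? /negP[]; lia.
move=> k; rewrite mem_ups => /andP[upk _]; rewrite -!mulrDl; congr (_ * _).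
rewrite /incidence (negPf dr) share_edgeE upk dr /= -!natrD; congr (_%:R).
move: upk; case: k => [[[] h] p] // _; rewrite !xpair_eqE /v1 /v2 /v3.
rewrite /height /pos /=; clear; lia.
Qed.

(** [B] replaces the unit columns of the left leg by kernel functions and has determinant 1 or -1.
    In the product [P] the rows of [downs T] vanish on these columns, leaving a unitriangular block
    and the kernel values on [X]. *)
Let absdet_kernel : absdet origin origin incidence (downs T ++ X) (ups T)
  = absdet origin origin leg_kernel X legs.
Proof.
have [szR szH szT] := size_downs_ups.
pose ks := map right_of (downs T) ++ legs.
have ks_T : perm_eq ks (ups T) := right_of_T.
have uniq_ks : uniq ks by rewrite (perm_uniq ks_T) uniq_ups.
pose B (u c : utri) := if c \in legs then leg_kernel u c else (u == c)%:R.
pose P (r c : utri) :=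
  if c \in legs then (if upward r then leg_kernel r c else 0) else incidence r c.
have Rnotleg (c : utri) : c \in map right_of (downs T) -> (c \in legs) = false.
  move=> cr; apply/negP => cl; move: uniq_ks; rewrite cat_uniq => /and3P[_ /hasPn/(_ _ cl)].
  by rewrite /= cr.
have szk : size (downs T ++ X) = size ks by rewrite (perm_size ks_T).
have PE : absdet origin origin P (downs T ++ X) ks
    = absdet origin origin incidence (downs T ++ X) ks * absdet origin origin B ks ks.
  apply: absdet_mul => // r c rTX cks; rewrite /P /B.
  have pick (F : utri -> rat) v : v \in ks -> \sum_(k <- ks) F k * (k == v)%:R = F v.
    move=> vin; rewrite (bigD1_seq v) //= eqxx mulr1 big1 ?addr0 // => k kv.
    by rewrite (negPf kv) mulr0.
  case: ifP => cl; last by rewrite pick.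
  have [upr|dr] := boolP (upward r).
    have rks : r \in ks.
      rewrite (perm_mem ks_T) mem_ups upr; move: rTX.
      by rewrite mem_cat mem_downs upr => /sub_XH/(fsubsetP sub_HT).
    rewrite -(pick (fun k => leg_kernel k c) r rks); apply: eq_bigr => k _.
    by rewrite /incidence upr mulrC eq_sym.
  rewrite (perm_big _ ks_T) /= leg_kernel_sum //.
  by move: rTX; rewrite mem_cat => /orP[//|/upX]; rewrite (negPf dr).
have BE : absdet origin origin B ks ks = 1.
  pose ks' := legs ++ map right_of (downs T).
  have kk' : perm_eq ks ks' by rewrite perm_catC.
  rewrite (absdet_perm origin origin B _ kk' kk') // absdet_lblock // => [|r c rl cr]; last first.
    rewrite /B Rnotleg //; case: eqP => // rc; move: rl; rewrite rc Rnotleg //.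
  have unit_B (s : seq utri) : {subset s <= ks} -> uniq s -> (forall r r' : utri,
      r \in s -> r' \in s -> `|B r r'| = (r == r')%:R) -> absdet origin origin B s s = 1.
    move=> sks us Bs; rewrite -{2}(map_id s) (absdet_trig origin origin (rank := fun=> 0)) //.
      by rewrite big_seq big1 // => r rs; rewrite Bs // eqxx.
    by move=> r r' rs r's neq _; apply/normr0_eq0; rewrite Bs // (negPf neq).
  move: (uniq_ks); rewrite cat_uniq => /and3P[ur _ ul].
  rewrite !unit_B ?mulr1 // => [|r r' _ r'r||r r' rl r'l].
  - by move=> r rr; rewrite mem_cat rr.
  - by rewrite /B Rnotleg // normr_nat.
  - by move=> r rr; rewrite mem_cat rr orbT.
  rewrite /B r'l /leg_kernel; move: rl r'l; rewrite !mem_legs.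
  move=> /and3P[upr /eqP p1 rT] /and3P[upr' /eqP p1' r'T].
  rewrite p1 subrr expr1 mulN1r normrN.
  have -> : (r == r') = (height r' - height r == 0).
    move: upr upr' p1 p1'; case: (r) (r') => [[[] h] p] [[[] h'] p'] //.
    rewrite /pos /height /= => _ _ -> ->; rewrite !xpair_eqE eqxx andbT /=.
    by rewrite subr_eq0 eq_sym.
  case: (height r' - height r) => [k|k]; last by rewrite binomz_lt0 ?normr0.
  by rewrite (binomz_nat 0 k) bin0n normr_nat.
rewrite (absdet_perm origin origin incidence szT (perm_refl _) (cs' := ks));
  last by rewrite perm_sym.
rewrite -[LHS]mulr1 -BE -PE absdet_lblock ?size_map //.
(* Of the neighbours of [r], only [right_of r] has a position beyond that of [r]. *)
- rewrite (absdet_trig origin origin (rank := pos)) ?uniq_downs //.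
    rewrite big_seq big1 ?mul1r => [|r rT].
      apply: eq_absdet => [|r c rX cl]; first by rewrite size_map size_iota size_X.
      by rewrite /P cl upX.
    rewrite /P Rnotleg ?map_f //; move: rT; rewrite mem_downs => /andP[dr _].
    rewrite /incidence (negPf dr) share_edgeE /right_of (negPf dr).
    by rewrite /height /pos /= -/(height r) -/(pos r) !eqxx orbT normr1.
  move=> r r' rT r'T neq lep; rewrite /P Rnotleg ?map_f //; apply/eqP.
  move: rT r'T; rewrite !mem_downs => /andP[dr _] /andP[dr' _].
  rewrite /incidence (negPf dr) pnatr_eq0 eqb0; apply: contraNN neq.
  rewrite share_edgeE /right_of (negPf dr') => /and3P[_ _].
  move: dr dr' lep; case: r r' => [[[] h] p] [[[] h'] p'] // _ _.
  by rewrite /height /pos /= !xpair_eqE eqxx /=; clear; lia.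
- by rewrite size_iota size_X.
move=> r c rT cl; rewrite /P cl; move: rT; rewrite mem_downs => /andP[/negPf-> _] //.
Qed.

Lemma M_trapezoid_holes : (M R)%:R = absdet origin 0%N
  (fun u h => binomz (pos u - 1) (h%:Z - height u)) X (iota 0 n).
Proof.
have [szR szH szT] := size_downs_ups.
have [ds ds_R sorted_ds] : exists2 ds, perm_eq ds (downs R) & pairwise rowmajor ds.
  apply: (sort_rowmajor (b := false)); first exact: uniq_downs.
  by move=> u; rewrite mem_downs => /andP[/negPf].
have [us us_R sorted_us] : exists2 us, perm_eq us (ups R) & pairwise rowmajor us.
  apply: (sort_rowmajor (b := true)); first exact: uniq_ups.
  by move=> u; rewrite mem_ups => /andP[].
have szd : size ds = size (downs R) := perm_size ds_R.
have szu : size us = size (downs R) by rewrite szR; apply: perm_size.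
rewrite (M_absdet origin ds_R us_R szd szu sorted_ds sorted_us crossings_parity).
rewrite (absdet_perm origin origin incidence _ ds_R us_R) ?szd ?szu // -absdet_fill.
have szX : size X = size (iota 0 n) by rewrite size_iota size_X.
(* The sign in [leg_kernel] depends on the row only. *)
rewrite absdet_kernel absdet_scale ?size_map //; last first.
  by move=> r _; rewrite normr_sign.
by rewrite -[X in absdet _ _ _ X _]map_id (absdet_map origin 0%N).
Qed.

End Holes.

(** * Column reduction *)

(** For a position [p >= 1] this counts the paths of [p - 1] steps from [u] to the left leg at
    height [h], each step going one position left and keeping the height or raising it by one. *)
Definition path_count (u : utri) (h : nat) : rat :=
  binomz (pos u - 1) (h%:Z - height u).

(* [k = l + n2 - 1] translates the column index into the summation index [l] of
   [D_term]. *)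
Definition column_op (n2 : nat) (N : int) (k j : nat) : rat :=
  binomz k (k%:Z - n2%:Z) * binomz N (j%:Z - 1 - (k%:Z - n2%:Z)).

(** Columns start at [n2] because the left corner hole uses up the first [n2]. *)
Definition reduced (n2 : nat) (N : int) (m : nat) (u : utri) (j : nat) : rat :=
  \sum_(k <- iota n2 m) path_count u k * column_op n2 N k j.

Lemma big_iota (R : nmodType) n m (F : nat -> R) :
  \sum_(k <- iota n m) F k = \sum_(t < m) F (n + t)%N.
Proof.
rewrite -(big_mkord xpredT (fun t => F (n + t)%N)) -{1}[n]addn0 iotaDl big_map.
by rewrite /index_iota subn0.
Qed.

(** The entries with [j - 1 < k - n2] vanish, and for [j - 1 = k - n2] the second factor is 1. *)
Lemma absdet_column_op n2 N m :
  absdet 0%N 0%N (column_op n2 N) (iota n2 m) (iota 1 m)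
  = \prod_(1 <= j < m.+1) binomz ((j + n2)%N%:Z - 1) (j%:Z - 1).
Proof.
have -> : iota 1 m = map (fun k => k - n2 + 1)%N (iota n2 m).
  rewrite -{2}[n2]addn0 iotaDl -map_comp -[1%N]addn0 iotaDl.
  by apply: eq_map => k /=; rewrite addKn addnC.
rewrite (absdet_trig 0%N 0%N (rank := fun k : nat => - k%:Z)) ?iota_uniq //.
  rewrite [RHS](big_addn 0 _ 1) subSS subn0 /index_iota subn0.
  rewrite -{1}[n2]addn0 iotaDl big_map.
  apply: eq_bigr => k _; rewrite /column_op.
  have -> : (n2 + k - n2 + 1)%N%:Z - 1 - ((n2 + k)%N%:Z - n2%:Z) = 0 by lia.
  have -> : (n2 + k)%N%:Z - n2%:Z = k%:Z by lia.
  have -> : (k + 1 + n2)%N%:Z - 1 = (n2 + k)%N%:Z by lia.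
  have -> : (k + 1)%N%:Z - 1 = k%:Z by lia.
  by rewrite binomz0 mulr1 binomz_nat normr_nat.
move=> k k'; rewrite !mem_iota => kin k'in neq le_k; rewrite /column_op.
by rewrite [X in _ * X]binomz_lt0 ?mulr0 //; lia.
Qed.

(** At height 0 the entries form Pascal's triangle, which is unitriangular. *)
Lemma absdet_corner n2 :
  absdet origin 0%N path_count (base (0, 1, n2)) (iota 0 n2) = 1.
Proof.
have -> : iota 0 n2 = map (fun u => `|(pos u - 1)%R|%N) (base (0, 1, n2)).
  rewrite -map_comp -[LHS]map_id; apply: eq_map => q /=.
  by rewrite /pos /=; lia.
rewrite (absdet_trig origin 0%N (rank := pos)) ?uniq_base //.
  rewrite big_seq big1 // => u; rewrite mem_base /= => /and4P[_ /eqP h0 p1 _].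
  rewrite /path_count h0 subr0.
  have -> : pos u - 1 = `|(pos u - 1)%R|%N%:Z by lia.
  by rewrite binomz_nat absz_nat binn normr1.
move=> u v; rewrite !mem_base /= => /and4P[uu /eqP hu pu _] /and4P[uv /eqP hv pv _] neq le_uv.
rewrite /path_count hu subr0.
have -> : pos u - 1 = `|(pos u - 1)%R|%N%:Z by lia.
rewrite binomz_nat bin_small //.
have : pos u != pos v.
  apply: contraNneq neq; move: uu uv hu hv; case: (u) (v) => [[[] h] p] [[[] h'] p'] //.
  by rewrite /height /pos /= => _ _ -> -> ->.
lia.
Qed.

(** With [k = n2 + t], the two binomials other than that of [N] multiply to
    [C(n2+m+i, n2) C(m+i, t)]. The first factor is constant; summing over [t] against the upper
    entry [-m] turns [m+i] into [i] by Chu-Vandermonde. This is the reason for the value of [N]. *)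
Lemma reduced_right n2 m m' (i j : nat) u : (0 < j <= m')%N ->
  height u = 0 -> pos u - 1 = (n2 + (m + i))%N ->
  reduced n2 (- m%:Z) m' u j = 'C(n2 + (m + i), n2)%:R * 'C(i, j.-1)%:R.
Proof.
move=> lej hu pu; rewrite /reduced big_iota.
rewrite -(binomz_nat i) (_ : i%:Z = (m + i)%N%:Z + - m%:Z); last by lia.
rewrite -(@binomz_vandermonde _ m'); last by lia.
rewrite big_distrr; apply: eq_bigr => t _; rewrite /path_count /column_op hu pu subr0.
have -> : (n2 + t)%N%:Z - n2%:Z = t%:Z by lia.
have -> : j%:Z - 1 - t%:Z = j.-1%:Z - t%:Z by lia.
by rewrite [RHS]/= !binomz_nat !mulrA -!natrM mul_bin_bin.
Qed.

(** Substitute [k = l + n2 - 1]. Column [j] of the block is column [j + n1] of [reduced], and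
    vanishing terms extend each sum to the common cut-off [n1 + r]. *)
Lemma seq_mx_D_block n1 n2 N r s (h p x y : int) :
  p = x + 1 -> h = n2%:Z - y ->
  seq_mx origin 0%N s r (reduced n2 N (n1 + r)) (base (h, p, s)) (iota n1.+1 r)
  = D_block n1 n2 N s r x y.
Proof.
move=> -> ->; apply/matrixP => i j; rewrite !mxE (nth_map 0%N) ?size_iota //.
rewrite !nth_iota // add0n -(@D_sumE _ _ _ _ _ _ (n1 + r).+1); last first.
  by rewrite ltnS addnC leq_add2l.
rewrite /reduced big_iota (big_addn 0 _ 1) subSS subn0 big_mkord.
apply: eq_bigr => t _; rewrite /path_count /column_op /D_term /height /pos /=.
by rewrite -mulrA; congr (binomz _ _ * (binomz _ _ * binomz _ _)); lia.
Qed.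

(** * Evaluation for the six holes *)

Theorem theorem9 (n1 n2 n3 k1 k2 k3 a b1 b2 b3 : nat)
    (even_a : ~~ odd a) (even_b1 : ~~ odd b1)
    (even_b2 : ~~ odd b2) (even_b3 : ~~ odd b3)
    (defined : S_defined n1 n2 n3 a b1 b2 b3 k1 k2 k3) :
  (M (S_region n1 n2 n3 a b1 b2 b3 k1 k2 k3))%:R =
    (\prod_(1 <= i < n1.+1)
        binomz ((n2 + n3 + a + b1 + b2 + b3 + i)%N%:Z - 1) n2%:Z)
    * (\prod_(1 <= j < (a + b1 + b2 + b3 + n1).+1)
        (binomz ((j + n2)%N%:Z - 1) (j%:Z - 1))^-1)
    * `| \det (D_matrix n1 n2 n3 a b1 b2 b3 k1 k2 k3) | :> rat.
Proof.
(* [r] is the order of [D_matrix]; [m] is [-N], and the hole of side [n1] starts at position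
   [n2 + m + 1]. *)
pose r := (b3 + a + b1 + b2)%N; pose m := (n3 + a + b1 + b2 + b3)%N.
pose t2 : int * int * nat := (0, (n2 + n3 + a + b1 + b2 + b3 + 1)%N%:Z, n1).
pose t3 := (n3%:Z - (2 * k3)%N%:Z, (n1 + a./2 + b1 + k3 + 1)%N%:Z, b3).
pose t4 : int * int * nat := ((n3 + b3)%N%:Z, (n1 + b1 + 1)%N%:Z, a).
pose t5 := ((n3 + a./2 + b3 + k1)%N%:Z, n1%:Z - (2 * k1)%N%:Z + 1, b1).
pose t6 : int * int * nat :=
  ((n3 + a./2 + b3 + k2)%N%:Z, (n1 + a./2 + b1 + k2 + 1)%N%:Z, b2).
pose hs : seq (int * int * nat) := [:: (0, 1, n2); t2; t3; t4; t5; t6].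
have /andP[sub_hs disj_hs] : S_defined n1 n2 n3 a b1 b2 b3 k1 k2 k3 := defined.
have sum_hs : (\sum_(t <- hs) t.2 = n1 + n2 + a + b1 + b2 + b3)%N.
  by rewrite !big_cons big_nil /=; clear; lia.
(* The sides [n1] and [n2] may be odd, but these two holes lie at height 0. *)
have even_hs : {in hs, forall t, odd t.2 -> t.1.1 = 0}.
  move=> t; rewrite !inE => /or4P[/eqP->|/eqP->|/eqP->|/or3P[] /eqP->] //=.
  - by rewrite (negPf even_b3).
  - by rewrite (negPf even_a).
  - by rewrite (negPf even_b1).
  - by rewrite (negPf even_b2).
have := @M_trapezoid_holes (n1 + n2 + a + b1 + b2 + b3) (n1 + n2 + a + b1 + b2 + b3 + n3)
  hs (leq_addr _ _) sub_hs disj_hs sum_hs even_hs.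
rewrite -[X in (M X)%:R]/(S_region n1 n2 n3 a b1 b2 b3 k1 k2 k3) => ->.
rewrite -/path_count.
(* Ordered and bracketed like the row blocks of [D_matrix]. *)
pose rest := ((base t3 ++ base t4) ++ base t5) ++ base t6.
have -> : flatten [seq base t | t <- hs] = base (0, 1, n2) ++ (base t2 ++ rest).
  by rewrite /= cats0 /rest !catA.
have size_base t : size (base t) = t.2 by rewrite size_map size_iota.
have size_rest : size rest = r by rewrite !size_cat !size_base.
have -> : iota 0 (n1 + n2 + a + b1 + b2 + b3) = iota 0 n2 ++ iota n2 (n1 + r).
  by rewrite -iotaD; congr iota; rewrite /r; clear; lia.
(* The rows of the left corner hole vanish from column [n2] on, as [pos u - 1 < n2]. *)
rewrite absdet_lblock ?size_cat ?size_base ?size_iota ?size_rest //; last first.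
  move=> u h; rewrite mem_base mem_iota /= => /and4P[_ /eqP hu pu ltu] /andP[leh _].
  rewrite -/(path_count u h) /path_count hu subr0.
  have -> : pos u - 1 = `|(pos u - 1)%R|%N%:Z by move: pu; clear; lia.
  rewrite binomz_nat bin_small //; move: pu ltu leh; clear; lia.
rewrite absdet_corner mul1r.
pose N := - m%:Z; pose G := reduced n2 N (n1 + r).
have GE : absdet origin 0%N G (base t2 ++ rest) (iota 1 (n1 + r))
    = absdet origin 0%N path_count (base t2 ++ rest) (iota n2 (n1 + r))
      * absdet 0%N 0%N (column_op n2 N) (iota n2 (n1 + r)) (iota 1 (n1 + r)).
  by apply: absdet_mul; rewrite ?size_cat ?size_base ?size_rest ?size_iota.
have -> : (a + b1 + b2 + b3 + n1 = n1 + r)%N by rewrite /r; clear; lia.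
(* The product of inverse binomials is the inverse determinant of the column operation; it remains
   to evaluate the determinant of [G]. *)
rewrite prodfV mulrAC -(absdet_column_op n2 N).
have cop0 : absdet 0%N 0%N (column_op n2 N) (iota n2 (n1 + r)) (iota 1 (n1 + r)) != 0.
  rewrite absdet_column_op prodf_seq_neq0; apply/allP => j.
  rewrite mem_index_iota => /andP[j1 _] /=.
  have -> : (j + n2)%N%:Z - 1 = (j + n2).-1%:Z by move: j1; clear; lia.
  have -> : j%:Z - 1 = j.-1%:Z by move: j1; clear; lia.
  by rewrite binomz_nat pnatr_eq0 -lt0n bin_gt0; move: j1; clear; lia.
have G2 q j : (q < n1)%N -> (0 < j <= n1 + r)%N ->
    G (true, 0, (n2 + n3 + a + b1 + b2 + b3 + 1)%N%:Z + q%:Z) j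
    = 'C(n2 + (m + q), n2)%:R * 'C(q, j.-1)%:R.
  move=> ltq lej; apply: reduced_right => //.
  by rewrite /pos /m /=; clear; lia.
rewrite -[LHS](mulfK cop0) -GE; congr (_ / _).
(* As [q < n1], the factor [C(q, j-1)] clears the rows of the hole of side [n1] beyond column
   [n1]. *)
rewrite iotaD absdet_lblock ?size_base ?size_rest ?size_iota //; last first.
  move=> u j /mapP[q]; rewrite !mem_iota => /andP[_ ltq] -> /andP[le_j lt_j].
  rewrite G2 //; last by move: le_j lt_j; clear; lia.
  by rewrite (@bin_small q) ?mulr0 //; move: (ltq : (q < n1)%N) le_j; clear; lia.
(* The block of that hole is triangular; its diagonal entries [C(n2+m+q, n2)] are the factors
   [i = q + 1] of the first product. *)
congr (_ * _).
  rewrite [iota 1 n1](_ : _ = map succn (iota 0 n1)); last first.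
    by rewrite -[1%N]addn0 iotaDl; apply: eq_map.
  rewrite (absdet_map 0%N 0%N) // (eq_absdet _ _ (G := fun q j : nat =>
    'C(n2 + (m + q), n2)%:R * 'C(q, j)%:R)) //; last first.
    move=> q j; rewrite !mem_iota => /andP[_ ltq] /andP[_ ltj].
    by rewrite G2 //; move: ltj; clear; lia.
  rewrite -[X in absdet _ _ _ _ X]map_id.
  rewrite (absdet_trig 0%N 0%N (rank := fun q : nat => q%:Z)) ?iota_uniq //.
    rewrite [RHS](big_addn 0 _ 1) subSS subn0 /index_iota subn0.
    apply: eq_bigr => q _; rewrite binn mulr1 normr_nat -binomz_nat.
    by congr binomz; rewrite /m; clear; lia.
  move=> q q' _ _ neq le_qq'; rewrite (@bin_small q) ?mulr0 //.
  by move: neq le_qq'; clear; lia.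
rewrite /absdet size_rest; congr (`|\det _|).
rewrite !seq_mx_cat_r ?size_cat ?size_base //.
have NE : N = - n3%:Z - a%:Z - b1%:Z - b2%:Z - b3%:Z by rewrite /N /m; clear; lia.
rewrite /D_matrix -NE; congr (col_mx (col_mx (col_mx _ _) _) _);
  by apply: seq_mx_D_block; clear; lia.
Qed.
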